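(* Let $\{X_n\}_{n=1}^{\infty}$ be a sequence of non-Archimedean metric spaces with $\operatorname{diam}(X_n)<+\infty$ for each $n\in\mathbb{N}$, and let $X$ be a non-Archimedean metric space with $\operatorname{diam}(X)<+\infty$. Suppose that $\widehat{d}_{GH}(X_n,X)\to 0$ as $n\to\infty$. Then: (1) If $\operatorname{diam}(X)=0$, then $\operatorname{diam}(X_n)\to 0$ as $n\to\infty$. (2) If $\operatorname{diam}(X)>0$, then there exists $n_0\in\mathbb{N}$ such that $\operatorname{diam}(X_n)=\operatorname{diam}(X)$ for all $n>n_0$.
   Context: A non-Archimedean metric space $(X,\widehat{d}_X)$ is a set with a metric satisfying the strong triangle inequality $\widehat{d}_X(x,z)\le\max\{\widehat{d}_X(x,y),\widehat{d}_X(y,z)\}$. Here $\operatorname{diam}(X)=\sup\{\widehat{d}_X(x,y):x,y\in X\}$. The non-Archimedean Gromov-Hausdorff distance is $\widehat{d}_{GH}(X,Y)=\inf\{\widehat{d}_{H}(f(X),g(Y))\}$, the infimum being over all non-Archimedean metric spaces $(Z,\widehat{d}_Z)$ and all isometric embeddings $f:X\hookrightarrow Z$, $g:Y\hookrightarrow Z$, where $\widehat{d}_H$ is the Hausdorff distance between subsets of $Z$ (it may be $\infty$). *)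

(* Defs.v *)
From HB Require Import structures.
From mathcomp Require Import all_boot all_order all_algebra.
From mathcomp Require Import all_classical all_reals all_analysis.

Set Implicit Arguments.
Unset Strict Implicit.
Unset Printing Implicit Defensive.

Import Order.TTheory GRing.Theory Num.Theory.
Import numFieldNormedType.Exports.

Local Open Scope classical_set_scope.
Local Open Scope ring_scope.

Definition non_archimedean (R : realType) (X : metricType R) : Prop :=
  forall x y z : X, mdist x z <= Num.max (mdist x y) (mdist y z).

(* The supremum is taken in [0, +oo]: adjoining 0 only matters for the empty
   space, whose diameter is thus 0 instead of -oo (see diam_inhabited). *)
Definition diam (R : realType) (X : metricType R) : \bar R :=
  ereal_sup (0%E |` [set (mdist p.1 p.2)%:E | p in [set: X * X]]).

Lemma diam_inhabited (R : realType) (X : metricType R) (x : X) :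
  diam X = ereal_sup [set (mdist p.1 p.2)%:E | p in [set: X * X]].
Proof.
rewrite /diam; congr ereal_sup; apply/setUidPr => _ ->.
by exists (x, x) => //=; rewrite mdistxx.
Qed.

(* Equal to +oo when no radius works, e.g. when exactly one set is empty. *)
Definition hausdorff_dist (R : realType) (Z : metricType R) (A B : set Z) :
    \bar R :=
  ereal_inf [set e%:E | e in [set e : R |
    [/\ 0 < e, A `<=` \bigcup_(b in B) ball b e
             & B `<=` \bigcup_(a in A) ball a e]]].

Definition isometric_embedding (R : realType) (X Z : metricType R)
    (f : X -> Z) : Prop :=
  forall x y : X, mdist (f x) (f y) = mdist x y.

Definition na_gromov_hausdorff_dist (R : realType) (X Y : metricType R) :
    \bar R :=
  ereal_inf [set r | exists (Z : metricType R) (f : X -> Z) (g : Y -> Z),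
    [/\ non_archimedean Z, isometric_embedding f, isometric_embedding g
      & r = hausdorff_dist (range f) (range g)]].

(* Main.v *)
(** In a non-Archimedean space, if every point of [f @` X] lies within [e] of
    [g @` Y], then the distance of two points of [X] is at most the maximum of
    [e] and a distance in [Y]. Hence
    [diam X <= max (diam Y) (d_GH X Y)], and symmetrically. When the last term
    tends to 0 this gives (1); as soon as it is below [diam X], it drops out of
    both inequalities, which gives (2). *)
Require Import Defs.
From mathcomp Require Import all_boot all_order all_algebra.
From mathcomp Require Import all_classical all_reals all_analysis.
Import Order.TTheory GRing.Theory Num.Theory.
Import numFieldNormedType.Exports.
Local Open Scope classical_set_scope.
Local Open Scope ring_scope.

Lemma le_mdist_diam {R : realType} {X : metricType R} (x y : X) :
  ((mdist x y)%:E <= diam X)%E.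
Proof. by apply: ereal_sup_ubound; right; exists (x, y). Qed.

Lemma diam_ge0 {R : realType} (X : metricType R) : (0 <= diam X)%E.
Proof. by apply: ereal_sup_ubound; left. Qed.

Lemma hausdorff_dist_ge0 {R : realType} (Z : metricType R) (A B : set Z) :
  (0 <= hausdorff_dist A B)%E.
Proof. by apply: le_ereal_inf_tmp => _ [e [e0 _ _] <-]; rewrite lee_fin ltW. Qed.

Lemma na_gromov_hausdorff_dist_ge0 {R : realType} (X Y : metricType R) :
  (0 <= na_gromov_hausdorff_dist X Y)%E.
Proof.
apply: le_ereal_inf_tmp => _ [Z [f [g [_ _ _ ->]]]].
exact: hausdorff_dist_ge0.
Qed.

Lemma hausdorff_distC {R : realType} (Z : metricType R) (A B : set Z) :
  hausdorff_dist A B = hausdorff_dist B A.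
Proof.
rewrite /hausdorff_dist; congr (ereal_inf (_ @` _)).
by apply/seteqP; split => e [].
Qed.

Lemma na_gromov_hausdorff_distC {R : realType} (X Y : metricType R) :
  na_gromov_hausdorff_dist X Y = na_gromov_hausdorff_dist Y X.
Proof.
rewrite /na_gromov_hausdorff_dist; congr ereal_inf.
by apply/seteqP; split => r [Z [f [g [hZ hf hg ->]]]];
  exists Z, g, f; split => //; exact: hausdorff_distC.
Qed.

(** Choose [y], [y'] with [g y], [g y'] within [e] of [f x], [f x'], and apply the strong triangle
    inequality twice along [f x], [g y], [g y'], [f x']: the two outer steps contribute only [e],
    not a sum. *)
Lemma na_mdist_le {R : realType} {X Y Z : metricType R} {f : X -> Z}
    {g : Y -> Z} {e : R} :
  non_archimedean Z -> isometric_embedding f -> isometric_embedding g ->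
  range f `<=` \bigcup_(b in range g) ball b e ->
  forall x x' : X, exists y y' : Y, mdist x x' <= Num.max (mdist y y') e.
Proof.
move=> hZ hf hg hfg x x'.
have close u : exists y, mdist (g y) (f u) < e.
  have [|_ [y _ <-]] := hfg (f u); first by exists u.
  by rewrite ballEmdist; exists y.
have [y yx] := close x; have [y' yx'] := close x'; exists y, y'.
rewrite -hf -hg (le_trans (hZ _ (g y) _))// ge_max; apply/andP; split.
  by rewrite le_max metric_sym (ltW yx) orbT.
by rewrite (le_trans (hZ _ (g y') _))// ge_max !le_max lexx (ltW yx') orbT.
Qed.

Lemma diam_le_max {R : realType} (X Y : metricType R) :
  (diam X <= maxe (diam Y) (na_gromov_hausdorff_dist X Y))%E.
Proof.
(* The first case is the value 0 adjoined in [diam]. *)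
apply: ge_ereal_sup => _ [->|[[x x'] _ <-]] /=; first by rewrite le_max diam_ge0.
(* Infima need not be attained, so argue by contradiction: a distance strictly above both terms
   leaves room for a space [Z] and then a radius [e] still below it. *)
rewrite leNgt gt_max; apply/negP => /andP[ltY].
move=> /ereal_inf_lt[_ [Z [f [g [hZ hf hg ->]]]]].
move=> /ereal_inf_lt[_ [e [_ hfg _] <-]]; rewrite lte_fin => lte.
have [y [y' le_xx']] := na_mdist_le hZ hf hg hfg x x'.
have := le_lt_trans (le_mdist_diam y y') ltY; rewrite lte_fin => lty.
by move: le_xx'; rewrite leNgt gt_max lty lte.
Qed.

Theorem theoremF (R : realType) (Xn : nat -> metricType R) (X : metricType R)
    (hXn : forall n : nat, non_archimedean (Xn n))
    (hdXn : forall n : nat, (diam (Xn n) < +oo)%E)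
    (hX : non_archimedean X)
    (hdX : (diam X < +oo)%E)
    (hlim : na_gromov_hausdorff_dist (Xn n) X @[n --> \oo] --> 0%E) :
  (diam X = 0%E -> diam (Xn n) @[n --> \oo] --> 0%E) /\
  ((0 < diam X)%E ->
    exists n0 : nat, forall n : nat, (n0 < n)%N -> diam (Xn n) = diam X).
Proof.
split=> [diamX0|diamX_gt0].
  apply: (squeeze_cvge _ (cvg_cst 0%E) hlim); apply: nearW => n.
  rewrite diam_ge0/= (le_trans (diam_le_max (Xn n) X))// diamX0.
  by rewrite ge_max lexx na_gromov_hausdorff_dist_ge0.
have [n0 _ small] : \forall n \near \oo,
    (na_gromov_hausdorff_dist (Xn n) X < diam X)%E.
  (* This open ray contains the limit 0 because [diam X] is positive. *)
  by apply: hlim [set r | (r < diam X)%E] _; apply: open_nbhs_nbhs; split;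
    first exact: open_ereal_lt_ereal.
exists n0 => n /ltnW /small /= ltX; apply/le_anti/andP; split.
  by rewrite (le_trans (diam_le_max (Xn n) X))// ge_max lexx ltW.
(* With the roles exchanged, [ltX] rules out the distance term, leaving [diam X <= diam (Xn n)]. *)
have := diam_le_max X (Xn n).
by rewrite na_gromov_hausdorff_distC le_max (leNgt _ (na_gromov_hausdorff_dist _ _))
  ltX orbF.
Qed.
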